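(* Let $E$ be a Banach space, let $I$ be an interval of $\mathbb R\cup\{\infty\}$ with $-\infty<\min I<\sup I\le\infty$, and let $g:I\to E$ be right regulated. Then: (a) For each compact subinterval $[a,b]$ of $I$, either $g$ is Riemann integrable on $[a,b]$, or there exists the greatest number $c_1$ in $(a,b]$ such that $g$ is locally Riemann integrable on $[a,c_1)$. (b) For each compact subinterval $[a,b]$ of $I$, either $g$ is Bochner integrable on $[a,b]$, or there exists the greatest number $c_2$ in $(a,b]$ such that $g$ is locally Bochner integrable on $[a,c_2)$. (c) For each compact subinterval $[a,b]$ of $I$, either $g$ is HL integrable on $[a,b]$, or there exists the greatest number $c_3$ in $(a,b]$ such that $g$ is locally HL integrable on $[a,c_3)$.
   Context: A mapping $g:I\to E$ is right regulated if it has a right limit $g(t+)\in E$ at every point $t\in I\setminus\{\sup I\}$. Compact subintervals $[a,b]$ are taken with $-\infty<a<b<\infty$. $g$ is locally integrable (in a given sense) on $[a,c)$ if it is integrable in that sense on every compact subinterval of $[a,c)$. A mapping $g:[a,b]\to E$ is HL (Henstock–Lebesgue) integrable if there is a mapping $f:[a,b]\to E$ such that for each $\epsilon>0$ there is $\delta:[a,b]\to(0,\infty)$ such that whenever $a=t_0<\dots<t_m=b$ and $\xi_i\in[t_{i-1},t_i]\subset(\xi_i-\delta(\xi_i),\xi_i+\delta(\xi_i))$ for $i=1,\dots,m$, then $\sum_{i=1}^m\|f(t_i)-f(t_{i-1})-g(\xi_i)(t_i-t_{i-1})\|<\epsilon$. It is Riemann integrable if there is $f:[a,b]\to E$ such that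 for each $\epsilon>0$ there is a constant $\delta>0$ such that whenever $a=t_0<\dots<t_m=b$ and $\xi_i\in[t_{i-1},t_i]\subset(\xi_i-\delta,\xi_i+\delta)$ for all $i$, then $\left\|\sum_{i=1}^m(f(t_i)-f(t_{i-1})-g(\xi_i)(t_i-t_{i-1}))\right\|<\epsilon$. Bochner integrability is the usual notion: $g$ is strongly measurable and $t\mapsto\|g(t)\|$ is Lebesgue integrable. *)

(* Defs.v *)
From HB Require Import structures.
From mathcomp Require Import all_boot all_order all_algebra.
From mathcomp Require Import all_classical all_reals all_analysis.
Import Order.TTheory GRing.Theory Num.Theory.
Import numFieldNormedType.Exports.

Set Implicit Arguments.
Unset Strict Implicit.
Unset Printing Implicit Defensive.

Local Open Scope classical_set_scope.
Local Open Scope ring_scope.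

(* A map on an interval I of R \cup {oo} is a total function on \bar R; its
   values outside I are never used.  The quantification over the reals only
   loses nothing when I is bounded below by a real: every point of I other than
   sup I is then finite, and I contains a right neighbourhood of it. *)
Definition right_regulated (R : realType) (E : normedModType R)
    (I : interval (\bar R)) (g : \bar R -> E) : Prop :=
  forall t : R, t%:E \in I -> t%:E <> ereal_sup [set` I] ->
    cvg ((fun s : R => g s%:E) @ t^'+).

(* a = t_0 < ... < t_m = b, with xi i the tag of [t_i, t_(i+1)]; the values of
   t beyond m and of xi from m on are irrelevant. *)
Definition fine_tagged_partition (R : realType) (delta : R -> R) (a b : R)
    (m : nat) (t xi : nat -> R) : Prop :=
  [/\ t 0%N = a, t m = b &
   forall i, (i < m)%N ->
     [/\ t i < t i.+1, xi i \in `[t i, t i.+1] &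
      `[t i, t i.+1]%classic `<=`
        `]xi i - delta (xi i), xi i + delta (xi i)[%classic]].

Definition HL_integrable (R : realType) (E : normedModType R)
    (g : R -> E) (a b : R) : Prop :=
  exists f : R -> E, forall eps : R, 0 < eps ->
  exists2 delta : R -> R, (forall x, x \in `[a, b] -> 0 < delta x) &
  forall (m : nat) (t xi : nat -> R), fine_tagged_partition delta a b m t xi ->
    \sum_(i < m) `|f (t i.+1) - f (t i) - (t i.+1 - t i) *: g (xi i)| < eps.

Definition Riemann_integrable (R : realType) (E : normedModType R)
    (g : R -> E) (a b : R) : Prop :=
  exists f : R -> E, forall eps : R, 0 < eps ->
  exists2 delta : R, 0 < delta &
  forall (m : nat) (t xi : nat -> R),
    fine_tagged_partition (fun=> delta) a b m t xi ->
    `|\sum_(i < m) (f (t i.+1) - f (t i) - (t i.+1 - t i) *: g (xi i))| < eps.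

Definition strongly_measurable d (T : measurableType d) (R : realType)
    (E : normedModType R) (mu : {measure set T -> \bar R}) (D : set T)
    (g : T -> E) : Prop :=
  exists2 s : nat -> T -> E,
    forall n, finite_set (s n @` D) /\
      forall v : E, measurable (D `&` s n @^-1` [set v]) &
    {ae mu, forall x, D x -> s n x @[n --> \oo] --> g x}.

(* The completed measure lives on the Lebesgue (not merely Borel) measurable
   sets: with Borel sets, changing g on a null set could make its norm
   non-measurable. *)
Definition Bochner_integrable (R : realType) (E : normedModType R)
    (g : R -> E) (a b : R) : Prop :=
  strongly_measurable (@completed_lebesgue_measure R) `[a, b] g /\
  (@completed_lebesgue_measure R).-integrable `[a, b] (fun x => `|g x|%:E).

Definition integrable_on_compacts (R : realType) (E : normedModType R)
    (Int : (R -> E) -> R -> R -> Prop) (g : R -> E) (a c : R) : Prop :=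
  forall s t : R, s < t -> `[s, t]%classic `<=` `[a, c[%classic -> Int g s t.

Definition greatest (R : realType) (A : set R) (c : R) : Prop :=
  A c /\ ubound A c.

(* Main.v *)
Require Import Defs.
From HB Require Import structures.
From mathcomp Require Import all_boot all_order all_algebra.
From mathcomp Require Import all_classical all_reals all_analysis.
From mathcomp Require Import measurable_realfun ring lra.
Import Order.TTheory GRing.Theory Num.Theory.
Import numFieldNormedType.Exports.
Local Open Scope classical_set_scope.
Local Open Scope ring_scope.

(** In each of the three parts the second alternative always holds.  The set of
    the [c] such that [g] is locally integrable on [[a, c)] is closed under
    suprema, because a compact subinterval of [[a, sup)] ends before some member
    of the set ([greatest_integrable_on_compacts]); so only its non-emptiness
    matters.  The right limit at [a] bounds [g] on some [[a, r)]
    ([right_bounded]), and a bounded right regulated map is integrable on compact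
    intervals in all three senses ([integrable_bounded_right_regulated]).

    The reason is that such a map has only countably many discontinuities: just
    to the right of any point the oscillation is small, so the points whose
    every neighbourhood has oscillation above [eta] are isolated from the right
    ([countable_large_oscillation]).

    Lebesgue's argument for Riemann integrability is recast as follows.  Given
    [eta], cover the countable set of points of large oscillation by an open set
    [J] of small measure; compactness yields one [delta] such that every
    [delta]-ball centred in [[a, b]] lies in [J] or carries only small
    oscillation.  The function
    [phi x = 2 M |J `&` ]-oo, x]| + e x] then grows by less than [eta] on
    [[a, b]] and dominates the length of any interval in such a ball times the
    distance of any two values of [g] there ([exists_oscillation_majorant]).
    Polygonal maps whose slopes are sampled values of [g] are thereby uniformly
    Cauchy, and their limit [f] satisfies
    [|f v - f u - (v - u) g(xi)| <= phi v - phi u]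
    ([primitive_of_oscillation_majorants]).  Summed over a partition, the right
    side telescopes: with one constant gauge the sum of the norms is small, which
    is stronger than both Riemann and HL integrability.

    For Bochner integrability, sampling [g] on finer and finer grids gives simple
    maps that converge at each point of continuity. *)

Set Implicit Arguments.
Unset Strict Implicit.

(** * Functions dominated by a monotone function *)

(** The gaps to the right of distinct points of [A] are disjoint, so choosing a
    rational in each gap is an injection. *)
Lemma right_isolated_countable (R : realType) (A : set R) :
  (forall x, A x -> exists2 r, x < r & forall y, x < y < r -> ~ A y) ->
  countable A.
Proof.
move=> iso.
have /choice [q qP] : forall x, exists q : rat, A x ->
    x < ratr q /\ forall y, x < y < ratr q -> ~ A y.
  move=> x; have [Ax|nAx] := pselect (A x); last by exists 0.
  have [r xr rA] := iso x Ax.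
  have [q] := rat_in_itvoo xr; rewrite in_itv/= => /andP[xq qr].
  exists q => _; split=> // y /andP[xy yq].
  by apply: rA; rewrite xy (lt_trans yq).
apply: (@sub_countable _ _ _ [set: rat]) => //.
apply/pcard_injP; exists q => x y; rewrite !inE => Ax Ay exy.
have [xq xA] := qP x Ax; have [yq yA] := qP y Ay.
case: (ltgtP x y) => // xy.
- by case: (xA y) => //; rewrite xy exy.
- by case: (yA x) => //; rewrite xy -exy.
Qed.

(** [J] is an outer approximation of the null set [D], and [psi x] the measure of
    the part of [J] to the left of [x]: inside [J], [psi] grows at unit speed. *)
Lemma small_measure_majorant (R : realType) (D : set R) (eta : R) :
  countable D -> 0 < eta ->
  exists (J : set R) (psi : R -> R),
    [/\ open J, D `<=` J, {homo psi : x y / x <= y},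
        forall x, 0 <= psi x <= eta &
        forall x y, x <= y -> `[x, y] `<=` J -> y - x <= psi y - psi x].
Proof.
move=> cD eta0; set mu := @lebesgue_measure R.
have mD : measurable D by apply: countable_measurable.
have D0 : mu D = 0%E by exact: countable_lebesgue_measure0.
have [] := @lebesgue_regularity_outer R D eta mD _ eta0; first by rewrite [ltLHS]D0.
move=> J [oJ DJ JD].
have mJ : measurable J by exact: open_measurable.
have Jeta : (mu J <= eta%:E)%E.
  have -> : J = D `|` (J `\` D) by rewrite setDUK.
  apply: (le_trans (measureU2 _ _ _)) => //; first exact: measurableD.
  by rewrite [X in (X + _)%E]D0 add0e ltW.
have le_mu (A B : set R) : measurable A -> measurable B -> A `<=` B ->
    (mu A <= mu B)%E.
  by move=> mA mB AB; apply: le_measure; rewrite ?inE.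
pose Jx (x : R) := J `&` `]-oo, x]%classic.
have mJx x : measurable (Jx x) by apply: measurableI.
have Jxeta x : (mu (Jx x) <= eta%:E)%E.
  apply: le_trans Jeta; apply: le_mu => //; exact: subIsetl.
have fJ x : mu (Jx x) \is a fin_num.
  by rewrite ge0_fin_numE// (le_lt_trans (Jxeta x))// ltry.
exists J, (fun x => fine (mu (Jx x))); split=> //.
- move=> x y xy; rewrite fine_le//; apply: le_mu => //.
  by apply: setIS => z /=; rewrite !in_itv/= => /le_trans; apply.
- move=> x; rewrite fine_ge0//=.
  by rewrite -lee_fin fineK.
- move=> x y xy xyJ; rewrite -lee_fin EFinB EFinB !fineK//.
  rewrite leeBrDr//.
  have -> : (y%:E - x%:E = mu `]x, y]%classic)%E.
    rewrite /mu lebesgue_measure_itv/= lte_fin.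
    by case: ltgtP xy => // -> _; rewrite subee.
  have dj : `]x, y]%classic `&` Jx x = set0.
    apply/seteqP; split=> z //= []; rewrite in_itv/= => /andP[xz _] [_].
    by rewrite /= in_itv/= leNgt xz.
  rewrite -(measureU mu _ (mJx x) dj)//.
  apply: le_mu => //; first exact: measurableU.
  move=> z [|[Jz]] /=; rewrite !in_itv/=.
    move=> /andP[xz zy]; split; last by rewrite /= in_itv/=.
    by apply: xyJ; rewrite /= in_itv/= (ltW xz).
  by move=> zx; split=> //=; rewrite in_itv/= (le_trans zx).
Qed.

(** A mean value inequality, in which the bound needs to be known only to the
    right of each point: the supremum of the points up to which it propagates
    inherits it, as [F] is continuous and [phi] is nondecreasing, and would be
    overtaken if it were less than [v]. *)
Lemma local_to_global_increment (R : realType) (E : normedModType R)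
    (F : R -> E) (phi : R -> R) (u v : R) :
  continuous F -> {homo phi : x y / x <= y} -> u <= v ->
  (forall x, u <= x < v -> exists2 d, 0 < d &
     forall y, x <= y < x + d -> `|F y - F x| <= phi y - phi x) ->
  `|F v - F u| <= phi v - phi u.
Proof.
move=> cF mphi uv loc.
pose S := [set x | u <= x <= v /\ `|F x - F u| <= phi x - phi u].
have Su : S u by split; rewrite ?lexx ?subrr ?normr0.
have S0 : S !=set0 by exists u.
have ubS : ubound S v by move=> x [/andP[]].
have hsS : has_sup S by split=> //; exists v.
set c := sup S.
have uS (x : R) : S x -> x <= c by apply: ub_le_sup; exists v.
have uc : u <= c by exact: uS.
have cv : c <= v by exact: ge_sup.
have Pc : `|F c - F u| <= phi c - phi u.
  apply/ler_addgt0Pr => e e0.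
  have /(@cvgrPdist_lt _ _ _ _ _ F) /(_ _ e0) := cF c.
  move=> /nbhs_ballP [d /= d0 dF].
  have [y Sy cy] := sup_adherent d0 hsS.
  have yc := uS _ Sy.
  have {dF} Fcy : `|F c - F y| < e.
    by apply: dF; rewrite /ball/= ger0_norm ?subr_ge0// ltrBlDr addrC -ltrBlDr.
  have [_ Py] := Sy.
  rewrite (le_trans (ler_distD (F y) _ _))// addrC lerD// ?(ltW Fcy)//.
  by rewrite (le_trans Py)// lerB// mphi.
have [cltv|] := ltP c v; last first.
  by move=> vc; have -> : v = c by apply/eqP; rewrite eq_le cv vc.
have [|d d0 dP] := loc c; first by rewrite uc.
pose y := Num.min v (c + d / 2).
have cy : c < y by rewrite lt_min cltv ltrDl divr_gt0.
have : S y.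
  split; first by rewrite (le_trans uc (ltW cy)) ge_min lexx.
  rewrite (le_trans (ler_distD (F c) _ _))//.
  have -> : phi y - phi u = (phi y - phi c) + (phi c - phi u) by ring.
  rewrite lerD//; apply: dP; rewrite (ltW cy)/= gt_min.
  by apply/orP; right; rewrite ltrD2l ltr_pdivrMr// ltr_pMr// ltr1n.
by move=> /uS; rewrite leNgt cy.
Qed.

(** * Oscillation of right regulated maps *)

Definition oscillation_le (R : realType) (E : normedModType R) (g : R -> E)
    (eta d x : R) : Prop :=
  forall y z, ball x d y -> ball x d z -> `|g y - g z| <= eta.

(** On a short open interval to the right of [x] all values of [g] are within
    [eta / 2] of the right limit, so [x] is isolated from the right in this
    set. *)
Lemma countable_large_oscillation (R : realType) (E : normedModType R)
    (g : R -> E) (eta : R) :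
  (forall x, cvg (g @ x^'+)) -> 0 < eta ->
  countable [set x | forall d, 0 < d -> ~ oscillation_le g eta d x].
Proof.
move=> rg eta0; apply: right_isolated_countable => x _.
have /cvg_ex[l /cvgrPdist_lt/(_ (eta / 2))] := rg x.
rewrite divr_gt0// => /(_ isT) /nbhs_ballP[r /= r0 rP].
have {}rP y : x < y < x + r -> `|l - g y| < eta / 2.
  move=> /andP[xy yr]; apply: rP => //.
  by rewrite /ball/= distrC gtr0_norm ?subr_gt0// ltrBlDl.
exists (x + r) => [|y /andP[xy yr]]; first by rewrite ltrDl.
have d0 : 0 < Num.min (y - x) (x + r - y) by rewrite lt_min !subr_gt0 xy.
move=> /(_ _ d0); apply=> u v.
have near_l w : ball y (Num.min (y - x) (x + r - y)) w -> `|l - g w| < eta / 2.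
  rewrite /ball/= lt_min => /andP[]; rewrite !ltr_norml => ? ?.
  by apply: rP; lra.
move=> /near_l ul /near_l vl.
rewrite (le_trans (ler_distD l _ _))// [X in X + _]distrC.
by rewrite [leRHS]splitr lerD// ltW.
Qed.

(** The increment of [phi] over [[x, y]] replaces the Lebesgue integral of the
    local oscillation of [g]: it bounds the error made when the constant [g q] is
    integrated over [[x, y]] in place of the constant [g p].  The centre [z]
    may be the point [x] itself, when two sampled values near [x] are compared,
    or the tag of a partition interval, when its value is one of the two. *)
Definition oscillation_majorant (R : realType) (E : normedModType R) (g : R -> E)
    (a b delta : R) (phi : R -> R) : Prop :=
  {homo phi : x y / x <= y} /\
  forall z x y p q, a <= z <= b ->
    ball z delta x -> ball z delta y -> ball z delta p -> ball z delta q ->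
    x <= y -> (y - x) * `|g p - g q| <= phi y - phi x.

(** Near a point a ball lies in [J], where [phi] grows at speed at least [2 M],
    or has oscillation at most [e], and [phi] always grows at speed at least
    [e]. *)
Lemma exists_oscillation_majorant (R : realType) (E : normedModType R)
    (g : R -> E) (M a b eta : R) :
  (forall x, `|g x| <= M) -> (forall x, cvg (g @ x^'+)) -> a < b -> 0 < eta ->
  exists (delta : R) (phi : R -> R),
    [/\ 0 < delta, oscillation_majorant g a b delta phi & phi b - phi a < eta].
Proof.
move=> gM rg ab eta0.
have M0 : 0 <= M by exact: le_trans (normr_ge0 (g 0)) (gM 0).
(* Both terms of the majorant are kept below a share of eta: the slope e
   contributes eta / 4, and the open set at most 2 M eta / (4 (M + 1)), where
   M + 1 avoids a division by zero. *)
pose e := eta / (4 * (b - a)).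
have e0 : 0 < e by rewrite divr_gt0// mulr_gt0// subr_gt0.
have k0 : 0 < eta / (4 * (M + 1)) by rewrite divr_gt0// mulr_gt0// ltr_wpDl.
have [J [psi [oJ DJ mpsi psib psiJ]]] :=
  small_measure_majorant (countable_large_oscillation rg e0) k0.
pose Q (d x : R) := ball x d `<=` J \/ oscillation_le g e d x.
have QW x r x' d : Q r x -> ball x (r / 2) x' -> d <= r / 2 -> Q d x'.
  move=> + xx' dr.
  have sub : ball x' d `<=` ball x r.
    move=> w; rewrite [r]splitr => x'w.
    by apply: ball_triangle xx' _; exact: le_ball x'w.
  case=> [rJ|osc]; [left|right].
    exact: subset_trans rJ.
  by move=> u v /sub xu /sub xv; exact: osc.
have Qr x : exists2 r, 0 < r & Q r x.
  have [Jx|nJx] := pselect (J x).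
    have /nbhs_ballP[r /= r0 rJ] := open_nbhs_nbhs (conj oJ Jx).
    by exists r => //; left.
  have : ~ forall d, 0 < d -> ~ oscillation_le g e d x.
    by move=> /DJ.
  move=> /existsNP[r /not_implyP[r0 /contrapT osc]].
  by exists r => //; right.
(* Q d x persists for smaller d and nearby x, so compactness gives a d that is
   valid on all of [a, b], in the manner of a Lebesgue number. *)
have : \forall d \near 0^'+, `[a, b] `<=` Q d.
  have /compact_near_coveringP := @segment_compact R a b; apply => x _.
  have [r r0 Qrx] := Qr x.
  have r20 : 0 < r / 2 by rewrite divr_gt0.
  exists (ball x (r / 2), [set d | d <= r / 2]) => /= [|[x' d] /= [xx' dr]].
    by split; [exact: nbhsx_ballx|exact: nbhs_right_le].
  exact: QW Qrx xx' dr.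
move=> nQ.
have [delta [delta0 Qdelta]] : exists delta, 0 < delta /\ `[a, b] `<=` Q delta.
  near (0 : R)^'+ => d; exists d; split; first by near: d; exact: nbhs_right_gt.
  by near: d.
exists delta, (fun x => 2 * M * psi x + e * x); split=> //=; first split=> /=.
- move=> x y xy; apply: lerD; apply: ler_wpM2l => //; last exact: ltW.
    exact: mulr_ge0.
  exact: mpsi.
- move=> z x y p q zab zx zy zp zq xy.
  have -> : 2 * M * psi y + e * y - (2 * M * psi x + e * x) =
     2 * M * (psi y - psi x) + e * (y - x) by ring.
  have psi0 : 0 <= psi y - psi x by rewrite subr_ge0 mpsi.
  have yx0 : 0 <= y - x by rewrite subr_ge0.
  have eyx0 : 0 <= e * (y - x) by rewrite mulr_ge0// ltW.
  have [|zJ|osc] := Qdelta z; first by rewrite /= in_itv.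
    have le2M : `|g p - g q| <= 2 * M.
      by rewrite (le_trans (ler_normB _ _))// mulr_natl mulr2n lerD.
    rewrite -[leLHS]addr0 lerD//.
    rewrite (le_trans (ler_wpM2l yx0 le2M))// mulrC ler_wpM2l ?mulr_ge0//.
    apply: psiJ => // w; rewrite /= in_itv/= => /andP[xw wy]; apply: zJ.
    move: zx zy; rewrite /ball/= !ltr_norml => /andP[? ?] /andP[? ?].
    by apply/andP; split; lra.
  rewrite -[leLHS]add0r; apply: lerD; first by rewrite mulr_ge0// mulr_ge0.
  by rewrite mulrC ler_wpM2r//; exact: osc.
- have -> : 2 * M * psi b + e * b - (2 * M * psi a + e * a) =
     2 * M * (psi b - psi a) + e * (b - a) by ring.
  have -> : e * (b - a) = eta / 4.
    by rewrite /e; field; rewrite subr_eq0 gt_eqF.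
  have : psi b - psi a <= eta / (4 * (M + 1)).
    have /andP[_ ?] := psib b; have /andP[? _] := psib a; lra.
  move=> /(ler_wpM2l (mulr_ge0 (ler0n R 2) M0)) h.
  rewrite (le_lt_trans (lerD h (lexx _)))//.
  have -> : 2 * M * (eta / (4 * (M + 1))) = (eta / 2) * (M / (M + 1)).
    by field; rewrite gt_eqF// ltr_wpDl.
  have : (eta / 2) * (M / (M + 1)) <= eta / 2.
    rewrite ler_piMr ?divr_ge0 ?(ltW eta0)//.
    by rewrite ler_pdivrMr ?ltr_wpDl// mul1r lerDl.
  lra.
Unshelve. all: by end_near. Qed.

(** * Construction of a primitive *)

(** The polygonal map over a grid of mesh [h], with the value of [g] at the left
    end of each cell as slope.  It is described only by what
    [local_to_global_increment] needs, its right slopes. *)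
Lemma polygonal_primitive (R : realType) (E : normedModType R) (g : R -> E)
    (a b h : R) : 0 < h ->
  exists F : R -> E, [/\ continuous F, F a = 0 &
    forall x, a <= x < b -> exists2 p, ball x h p &
      exists2 d, 0 < d & forall y, x <= y < x + d -> F y - F x = (y - x) *: g p].
Proof.
move=> h0.
suff steps n : exists F : R -> E, [/\ continuous F, F a = 0 &
    forall x, a <= x < a + n%:R * h -> exists2 p, ball x h p &
      exists2 d, 0 < d & forall y, x <= y < x + d -> F y - F x = (y - x) *: g p].
  have [F [cF Fa FP]] := steps (Num.Def.trunc ((b - a) / h)).+1.
  exists F; split=> // x /andP[ax xb]; apply: FP; rewrite ax/=.
  rewrite (lt_le_trans xb)// -lerBlDl -ler_pdivrMr// ltW//.
  exact: truncnS_gt.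
elim: n => [|n [F [cF Fa FP]]].
  exists (fun=> 0); split=> [x|//|x]; first exact: cvg_cst.
  by rewrite mul0r addr0 => /andP[/le_lt_trans/[apply]]; rewrite ltxx.
set c := a + n%:R * h in FP *.
have ac : a <= c by rewrite lerDl mulr_ge0// ltW.
(* Freeze the map at the last grid point c, and add a ray of slope g c
   there. *)
exists (fun x => F (Num.min x c) + Num.max (x - c) 0 *: g c); split.
- move=> x; apply: cvgD.
    apply: (@continuous_comp _ _ _ (fun x => Num.min x c) F); last exact: cF.
    by apply: (@continuous_min R R id (fun=> c)); [exact: cvg_id|exact: cvg_cst].
  apply: cvgZr_tmp.
  apply: (@continuous_max R R (fun x => x - c) (fun=> 0)); last exact: cvg_cst.
  by apply: cvgB; [exact: cvg_id|exact: cvg_cst].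
- by rewrite min_l// Fa max_r ?subr_le0// scale0r addr0.
move=> x /andP[ax xb].
have [xc|cx] := ltP x c.
  have [|p xp [d d0 dP]] := FP x; first by rewrite ax.
  exists p => //; exists (Num.min d (c - x)) => [|y /andP[xy]].
    by rewrite lt_min d0 subr_gt0.
  rewrite -ltrBlDl lt_min !ltrBlDl subrKC => /andP[yd yc].
  rewrite !min_l ?(ltW xc) ?(ltW yc)// !max_r ?subr_le0 ?(ltW xc) ?(ltW yc)//.
  by rewrite !scale0r !addr0 dP// xy.
exists c.
  rewrite /ball/= ger0_norm ?subr_ge0// ltrBlDl.
  by move: xb; rewrite -natr1 mulrDl mul1r addrA.
exists 1 => // y /andP[xy _].
have cy := le_trans cx xy.
rewrite !min_r// !max_l ?subr_ge0//.
by rewrite [F c + _]addrC addrKA -scalerBl; congr (_ *: _); ring.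
Qed.

(** The maps [H] in view are differences of two polygonal primitives, and
    polygonal primitives minus a linear map whose slope is a value of [g]: in
    both cases the right slopes are differences of neighbouring values of
    [g]. *)
Lemma oscillation_majorant_increment (R : realType) (E : normedModType R)
    (g : R -> E) (a b delta : R) (phi : R -> R) (H : R -> E) (u v : R) :
  oscillation_majorant g a b delta phi -> continuous H -> u <= v ->
  (forall x, u <= x < v -> exists z p q : R,
    [/\ a <= z <= b, ball z delta x, ball z delta p, ball z delta q &
     exists2 d, 0 < d &
       forall y, x <= y < x + d -> H y - H x = (y - x) *: (g p - g q)]) ->
  `|H v - H u| <= phi v - phi u.
Proof.
move=> [mphi phiP] cH uv HP; apply: local_to_global_increment => // x /HP.
move=> [z [p [q [zab zx zp zq [d d0 dP]]]]].
have zx0 : 0 < z + delta - x.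
  by move: zx; rewrite /ball/= ltr_norml => /andP[? ?]; lra.
exists (Num.min d (z + delta - x)); first by rewrite lt_min d0.
move=> y /andP[xy]; rewrite -ltrBlDl lt_min !ltrBlDl subrKC => /andP[yd yz].
rewrite dP ?xy// normrZ ger0_norm ?subr_ge0//.
apply: (phiP z) => //; move: zx; rewrite /ball/= !ltr_norml => /andP[? ?].
by apply/andP; split; lra.
Qed.

(** The primitive is the pointwise limit of polygonal primitives of mesh
    [1 / (n + 1)].  Once the mesh is below [delta], two of them differ by at most
    the increment of [phi], which is the Cauchy property; the same comparison
    with [y *: g xi] passes to the limit. *)
Lemma primitive_of_oscillation_majorants (R : realType)
    (E : completeNormedModType R) (g : R -> E) (a b : R) :
  (forall eta, 0 < eta -> exists (delta : R) (phi : R -> R),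
     [/\ 0 < delta, oscillation_majorant g a b delta phi &
       phi b - phi a < eta]) ->
  exists f : R -> E, forall eta, 0 < eta -> exists (delta : R) (phi : R -> R),
    [/\ 0 < delta, phi b - phi a < eta &
     forall u v xi, a <= u -> u <= v -> v <= b -> a <= xi <= b ->
       ball xi delta u -> ball xi delta v ->
       `|f v - f u - (v - u) *: g xi| <= phi v - phi u].
Proof.
move=> gP.
have /choice[F FP] := fun n => polygonal_primitive g a b
  (eqbRL (invr_gt0 _) (ltr0Sn _ n)).
have cvgF x : a <= x <= b -> cvg (F n x @[n --> \oo]).
  move=> /andP[ax xb]; apply: cauchy_cvg; apply: cauchy_exP => e e0.
  have [delta [phi [delta0 phiP phie]]] := gP e e0.
  have [N _ NP] := near_infty_natSinv_lt (PosNum delta0).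
  exists (F N x); exists N => // n /= Nn.
  have := oscillation_majorant_increment (H := fun y => F N y - F n y)
    (u := a) (v := x) phiP.
  have [cN N0 FN] := FP N; have [cn n0 Fn] := FP n.
  rewrite N0 n0 !subr0 => bd.
  rewrite -ball_normE /=; apply: le_lt_trans (bd _ ax _) _.
  - by move=> y; apply: cvgB; [exact: cN|exact: cn].
  - move=> y /andP[ay yx]; have yb := lt_le_trans yx xb.
    have [|p yp [d d0 dP]] := FN y; first by rewrite ay.
    have [|q yq [d' d'0 d'P]] := Fn y; first by rewrite ay.
    exists y, p, q; split.
    + by rewrite ay ltW.
    + exact: ballxx.
    + by apply: le_ball yp; rewrite ltW// NP/=.
    + by apply: le_ball yq; rewrite ltW// NP.
    + exists (Num.min d d') => [|w /andP[yw]]; first by rewrite lt_min d0.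
      rewrite -ltrBlDl lt_min !ltrBlDl => /andP[wd wd'].
      rewrite scalerBr -dP ?yw// -d'P ?yw//.
      by rewrite !opprD addrACA.
  - rewrite (le_lt_trans _ phie)// lerB//; exact: phiP.1.
exists (fun x => lim (F n x @[n --> \oo])) => eta eta0.
have [delta [phi [delta0 phiP phie]]] := gP eta eta0.
(* The sampling point of x may lie outside the ball around xi that contains x;
   halving the gauge keeps it within delta of xi. *)
exists (delta / 2), phi; split=> //; first by rewrite divr_gt0.
move=> u v xi au uv vb xiab xiu xiv.
have cu : cvg (F n u @[n --> \oo]).
  by apply: (cvgF u); rewrite au (le_trans uv).
have cv : cvg (F n v @[n --> \oo]).
  by apply: (cvgF v); rewrite vb (le_trans au).
have lim_uv := cvg_norm (cvgB (cvgB cv cu) (cvg_cst ((v - u) *: g xi))).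
apply: (cvgr_to_le (lim_uv _ _ _ _)).
have delta20 : 0 < delta / 2 by rewrite divr_gt0.
have [N _ NP] := near_infty_natSinv_lt (PosNum delta20).
exists N => // n /= Nn.
have [cn n0 Fn] := FP n.
have := oscillation_majorant_increment (H := fun y => F n y - y *: g xi)
    (u := u) (v := v) phiP.
have -> : F n v - v *: g xi - (F n u - u *: g xi) =
    F n v - F n u - (v - u) *: g xi.
  by rewrite scalerBl !opprD addrACA.
apply=> // [y|x /andP[ux xv]].
  by apply: cvgB; [exact: cn|apply: cvgZr_tmp; exact: cvg_id].
have [|p xp [d d0 dP]] := Fn x; first by rewrite (le_trans au ux) (lt_le_trans xv).
have xix : ball xi (delta / 2) x.
  move: xiu xiv; rewrite /ball/= !ltr_norml => /andP[? ?] /andP[? ?].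
  by apply/andP; split; lra.
exists xi, p, xi; split=> //.
- by apply: le_ball xix; lra.
- rewrite [delta]splitr; apply: ball_triangle xix _; apply: le_ball xp.
  by rewrite ltW// NP.
- exact: ballxx.
- exists d => // y xyd; rewrite scalerBr -dP// scalerBl.
  by rewrite !opprD addrACA.
Qed.

(** * Sums over tagged partitions *)

Lemma fine_partition_bounds (R : realType) (delta : R -> R) (a b : R)
    (m : nat) (t xi : nat -> R) :
  fine_tagged_partition delta a b m t xi ->
  forall i, (i < m)%N ->
    [/\ a <= t i, t i <= t i.+1, t i.+1 <= b & a <= xi i <= b].
Proof.
move=> [t0 tm tP].
have at_ i : (i <= m)%N -> a <= t i.
  elim: i => [|i IH] im; first by rewrite t0.
  by rewrite (le_trans (IH (ltnW im)))//; have [/ltW] := tP i im.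
have tb i : (i <= m)%N -> t (m - i)%N <= b.
  elim: i => [|i IH] im; first by rewrite subn0 tm.
  have mi : (m - i.+1 < m)%N by rewrite ltn_subrL (leq_trans _ im).
  rewrite (le_trans _ (IH (ltnW im)))// -[in leRHS](subnSK im).
  by have [/ltW] := tP _ mi.
move=> i im; have [/ltW tt xit _] := tP i im.
have ai := at_ i (ltnW im).
have bi : t i.+1 <= b by rewrite -(subKn im) tb// leq_subr.
split=> //; move: xit; rewrite in_itv/= => /andP[tx xt].
by rewrite (le_trans ai tx) (le_trans xt bi).
Qed.

(** The increments of [phi] over the intervals of the partition telescope. *)
Lemma uniform_gauge_sum (R : realType) (E : normedModType R) (f g : R -> E)
    (phi : R -> R) (a b delta : R) (m : nat) (t xi : nat -> R) :
  (forall u v x, a <= u -> u <= v -> v <= b -> a <= x <= b ->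
     ball x delta u -> ball x delta v ->
     `|f v - f u - (v - u) *: g x| <= phi v - phi u) ->
  fine_tagged_partition (fun=> delta) a b m t xi ->
  \sum_(i < m) `|f (t i.+1) - f (t i) - (t i.+1 - t i) *: g (xi i)| <=
    phi b - phi a.
Proof.
move=> fP tP; have bnd := fine_partition_bounds tP.
have [t0 tm tP'] := tP.
rewrite -t0 -tm -(telescope_sumr (fun i => phi (t i)) (leq0n m)) big_mkord.
apply: ler_sum => -[i im] _ /=; have [ai tt ib xib] := bnd i im.
have [_ _ sub] := tP' i im.
have inball y : t i <= y <= t i.+1 -> ball (xi i) delta y.
  move=> yt; have /= := sub y; rewrite !in_itv/= => /(_ yt) /andP[? ?].
  by rewrite /ball/= ltr_norml; apply/andP; split; lra.
by apply: fP => //; apply: inball; rewrite lexx tt.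
Qed.

(** * Bochner integrability *)

Lemma countable_discontinuity (R : realType) (E : normedModType R)
    (g : R -> E) :
  (forall x, cvg (g @ x^'+)) -> countable [set x | ~ {for x, continuous g}].
Proof.
move=> rg.
pose D n := [set x | forall d, 0 < d ->
  ~ oscillation_le g n.+1%:R^-1 d x].
apply: (@sub_countable _ _ _ (\bigcup_n D n)); last first.
  by apply: bigcup_countable => // n _; exact: countable_large_oscillation.
apply: subset_card_le => x /= ncx; apply: contrapT => nD; apply: ncx.
apply/cvgrPdist_lt => e e0.
have [N _ NP] := near_infty_natSinv_lt (PosNum e0).
have : ~ D N x by move=> DNx; apply: nD; exists N.
move=> /existsNP[d /not_implyP[d0 /contrapT osc]].
have := nbhsx_ballx x d d0; apply: filterS => y xy.
exact: le_lt_trans (osc _ _ (ballxx _ d0) xy) (NP N (leqnn N)).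
Qed.

(** A superlevel set of the norm is its interior together with some of the
    points of discontinuity of [g], hence a Borel set. *)
Lemma measurable_norm_countable_discontinuity (R : realType)
    (E : normedModType R) (g : R -> E) (D : set R) :
  countable [set x | ~ {for x, continuous g}] ->
  measurable D -> measurable_fun D (fun x => `|g x|).
Proof.
move=> cg mD; apply: (measurability _ (RGenOInfty.measurableE R)).
move=> _ [_ [r ->] <-]; apply: measurableI => //.
pose W : set R := [set x | r < `|g x|].
have -> : (fun x => `|g x|) @^-1` `]r, +oo[ = W.
  by apply/seteqP; split=> x; rewrite /W/= in_itv/= andbT.
have disc : W `\` W^° `<=` [set x | ~ {for x, continuous g}].
  move=> x [Wx nWx] cx; apply: nWx.
  exact: (cvgr_gt _ (cvg_norm cx) _ Wx).
have -> : W = W^° `|` (W `\` W^°) by rewrite setDUK//; exact: interior_subset.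
apply: measurableU; first by apply: open_measurable; exact: open_interior.
apply: countable_measurable => //; apply: sub_countable cg.
exact: subset_card_le.
Qed.

(** The simple maps sample [g] at the left neighbour of [x] in the grid
    [a + k / (n + 1)]; they converge wherever [g] is continuous.  Their fibres
    are countable unions of grid cells. *)
Lemma strongly_measurable_countable_discontinuity (R : realType)
    (E : normedModType R) (g : R -> E) (a b : R) :
  countable [set x | ~ {for x, continuous g}] ->
  strongly_measurable (@completed_lebesgue_measure R) `[a, b] g.
Proof.
move=> cg; pose p (n k : nat) : R := a + k%:R / n.+1%:R.
pose k (n : nat) (x : R) := Num.trunc ((x - a) * n.+1%:R).
have kP n x : a <= x -> p n (k n x) <= x < p n (k n x).+1.
  move=> ax; have : 0 <= (x - a) * n.+1%:R by rewrite mulr_ge0// subr_ge0.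
  move=> /truncn_itv; rewrite -ler_pdivrMr// -ltr_pdivlMr//=.
  by rewrite /p -lerBrDl -ltrBlDl.
have kE n x j : p n j <= x < p n j.+1 -> k n x = j.
  rewrite /p -lerBrDl -ltrBlDl ler_pdivrMr// ltr_pdivlMr// => /truncn_def.
  exact.
have pcvg (x : R) : a <= x -> {for x, continuous g} ->
    g (p n (k n x)) @[n --> \oo] --> g x.
  move=> ax cx; suff pk : p n (k n x) @[n --> \oo] --> x by exact: cvg_comp pk cx.
  apply/cvgrPdist_lt => e e0.
  have [N _ NP] := near_infty_natSinv_lt (PosNum e0).
  exists N => // n /= Nn; have /andP[px xp] := kP n x ax.
  have := NP n Nn; rewrite /= => ne.
  rewrite ger0_norm ?subr_ge0// (le_lt_trans _ ne)//.
  rewrite lerBlDl (le_trans (ltW xp))//.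
  by rewrite /p -[(k n x).+1%:R]natr1 mulrDl mul1r addrA.
exists (fun n x => g (p n (k n x))).
  move=> n; split.
    apply: (@sub_finite_set _ _ ((fun j => g (p n j)) @` `I_(k n b).+1)).
      move=> _ [x /= + <-]; rewrite in_itv/= => /andP[ax xb].
      exists (k n x) => //=; rewrite ltnS; apply: le_truncn.
      by rewrite ler_wpM2r// lerB.
    exact/finite_image/finite_II.
  move=> v; apply: sub_caratheodory.
  rewrite (_ : _ `&` _ = `[a, b] `&`
     \bigcup_(j in [set j | g (p n j) = v]) `[p n j, p n j.+1[%classic).
    apply: measurableI => //.
    by apply: bigcup_measurable => j _; exact: measurable_itv.
  apply/seteqP; split => x /= []; rewrite in_itv/= => /andP[ax xb] H; split.
  - by rewrite ?in_itv/= ?ax.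
  - by exists (k n x) => //=; rewrite in_itv/= kP.
  - by rewrite ?in_itv/= ?ax.
  - by case: H => j /= gj; rewrite in_itv/= => /kE ->.
exists [set x | ~ {for x, continuous g}]; split.
- by apply: sub_caratheodory; exact: countable_measurable.
- exact: countable_lebesgue_measure0.
- move=> x /= nP cx; apply: nP; rewrite in_itv/= => /andP[ax _].
  exact: pcvg.
Qed.

Lemma Bochner_integrable_countable_discontinuity (R : realType)
    (E : normedModType R) (g : R -> E) (M a b : R) :
  countable [set x | ~ {for x, continuous g}] ->
  (forall x, `|g x| <= M) -> Bochner_integrable g a b.
Proof.
move=> cg gM; split; first exact: strongly_measurable_countable_discontinuity.
apply: (@measurable_bounded_integrable _ _ _ (@completed_lebesgue_measure R)
  (fun x => `|g x|) `[a, b]).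
- exact: sub_caratheodory.
- apply: (@le_lt_trans _ _ (@lebesgue_measure R `[a, b]%classic)) => //.
  by rewrite lebesgue_measure_itv/=; case: ifP; rewrite ltry.
- move=> mD Y mY; apply: sub_caratheodory.
  by apply: measurable_norm_countable_discontinuity.
- exists M; split; first exact: num_real.
  by move=> y My x _ /=; rewrite normr_id (le_trans (gM x))// ltW.
Qed.

(** * Local integrability of right regulated maps *)

Definition clamp (R : realType) (a b x : R) : R := Num.max a (Num.min x b).

Lemma clamp_id (R : realType) (a b x : R) : a <= x <= b -> clamp a b x = x.
Proof. by move=> /andP[ax xb]; rewrite /clamp min_l// max_r. Qed.

Lemma clamp_itv (R : realType) (a b x : R) : a <= b -> a <= clamp a b x <= b.
Proof. by move=> ab; rewrite le_max lexx/= ge_max ab ge_min lexx orbT. Qed.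

(** Extending [g] by constants outside [[a, b]] makes the right limits exist
    everywhere: at [b] and beyond, the extension is constant to the right. *)
Lemma cvg_right_clamp (R : realType) (E : normedModType R) (g : R -> E)
    (a b : R) :
  a < b -> (forall x, a <= x < b -> cvg (g @ x^'+)) ->
  forall x, cvg ((fun y => g (clamp a b y)) @ x^'+).
Proof.
move=> ab rg x.
have eventually_eq (h : R -> E) (r : R) : x < r ->
    (forall y, x < y < r -> h y = g (clamp a b y)) -> cvg (h @ x^'+) ->
    cvg ((fun y => g (clamp a b y)) @ x^'+).
  move=> xr hg /cvg_ex[l hl]; apply/cvg_ex; exists l.
  apply: cvg_trans hl; apply: near_eq_cvg.
  near=> y; rewrite hg//; apply/andP; split.
    by near: y; exact: nbhs_right_gt.
  by near: y; exact: nbhs_right_lt.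
have [xa|ax] := ltP x a.
  apply: (eventually_eq (fun=> g a) a) => // [y /andP[_ ya]|].
    by rewrite /clamp max_l// ge_min ltW.
  exact: is_cvg_cst.
have [xb|bx] := ltP x b.
  apply: (eventually_eq g b) => // [y /andP[xy yb]|]; last by apply: rg; rewrite ax.
  by rewrite clamp_id// (le_trans ax (ltW xy)) ltW.
apply: (eventually_eq (fun=> g b) (x + 1)) => // [|y /andP[xy _]|].
- by rewrite ltrDl.
- by rewrite /clamp min_r ?max_r ?(ltW ab)// (le_trans bx) ?ltW.
- exact: is_cvg_cst.
Unshelve. all: by end_near. Qed.

Lemma eq_Bochner_integrable (R : realType) (E : normedModType R)
    (g h : R -> E) (a b : R) :
  (forall x, a <= x <= b -> g x = h x) ->
  Bochner_integrable g a b -> Bochner_integrable h a b.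
Proof.
move=> gh [[s sP sg] ig]; split.
  exists s => //; case: sg => N [mN N0 sub]; exists N; split=> // x /= nsx.
  apply: sub => /= sx; apply: nsx => Dx; rewrite -gh; first exact: sx.
  by move: Dx; rewrite in_itv.
apply: (@eq_integrable _ _ _ (@completed_lebesgue_measure R) `[a, b] _
  (fun x => `|g x|%:E)) => //; first exact: sub_caratheodory.
by move=> x; rewrite inE/= in_itv/= => xab; rewrite gh.
Qed.

(** All three notions see only the values on [[a, b]], so [g] may be replaced by
    its extension by constants, which is bounded and right regulated on the whole
    line. *)
Theorem integrable_bounded_right_regulated (R : realType)
    (E : completeNormedModType R) (g : R -> E) (M a b : R) :
  a < b -> (forall x, a <= x <= b -> `|g x| <= M) ->
  (forall x, a <= x < b -> cvg (g @ x^'+)) ->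
  [/\ Riemann_integrable g a b, Bochner_integrable g a b & HL_integrable g a b].
Proof.
move=> ab gM rg.
pose h x := g (clamp a b x).
have hM x : `|h x| <= M by apply: gM; exact: clamp_itv (ltW ab).
have rh : forall x, cvg (h @ x^'+) by exact: cvg_right_clamp.
have hg x : a <= x <= b -> h x = g x by move=> /clamp_id; rewrite /h => ->.
have [f fP] : exists f : R -> E, forall eta, 0 < eta ->
    exists2 delta : R, 0 < delta & forall (m : nat) (t xi : nat -> R),
    fine_tagged_partition (fun=> delta) a b m t xi ->
    \sum_(i < m) `|f (t i.+1) - f (t i) - (t i.+1 - t i) *: g (xi i)| < eta.
  have [|f fP] := @primitive_of_oscillation_majorants R E h a b.
    by move=> eta; exact: exists_oscillation_majorant hM rh ab.
  exists f => eta /fP[delta [phi [delta0 phie fd]]].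
  exists delta => // m t xi tP; apply: le_lt_trans phie.
  apply: uniform_gauge_sum tP.
  by move=> u v x au uv vb xab; rewrite -hg//; exact: fd.
split.
- exists f => eta /fP[delta delta0 H]; exists delta => // m t xi /H.
  by apply: le_lt_trans; exact: ler_norm_sum.
- apply: (eq_Bochner_integrable hg).
  exact: Bochner_integrable_countable_discontinuity (countable_discontinuity rh) hM.
- by exists f => eta /fP[delta delta0 H]; exists (fun=> delta).
Qed.

Lemma right_bounded (R : realType) (E : normedModType R) (g : R -> E) (a : R) :
  cvg (g @ a^'+) ->
  exists (M r : R), a < r /\ forall x, a <= x < r -> `|g x| <= M.
Proof.
move=> /cvg_ex[l /cvgrPdist_lt/(_ 1 ltr01)] /nbhs_ballP[r /= r0 rP].
exists (Num.max `|g a| (`|l| + 1)), (a + r); split; first by rewrite ltrDl.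
move=> x /andP[]; rewrite le_eqVlt => /predU1P[<-|ax] xr.
  by rewrite le_max lexx.
rewrite le_max; apply/orP; right.
have ballx : ball a r x.
  by rewrite /ball/= distrC gtr0_norm ?subr_gt0// ltrBlDl.
have /ltW gx := rP x ballx ax; rewrite -[g x](subrKC l).
by rewrite (le_trans (ler_normD _ _))// lerD2l distrC.
Qed.

(** The greatest [c] is the supremum: a compact subinterval of [[a, sup)] is
    already contained in [[a, c)] for some [c] in the set. *)
Lemma greatest_integrable_on_compacts (R : realType) (E : normedModType R)
    (Int : (R -> E) -> R -> R -> Prop) (g : R -> E) (a b c0 : R) :
  a < c0 <= b -> integrable_on_compacts Int g a c0 ->
  exists c, greatest
    [set c | a < c <= b /\ integrable_on_compacts Int g a c] c.
Proof.
move=> ac0b Ic0; set S := [set c | _].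
have Sc0 : S c0 by split.
have ubS : ubound S b by move=> x [/andP[]].
have supS : has_sup S by split; [exists c0|exists b].
have leS c : S c -> c <= sup S by apply: ub_le_sup; exists b.
exists (sup S); split=> //; split.
  rewrite (lt_le_trans _ (leS _ Sc0)) ?ge_sup//; first by exists c0.
  by case/andP: ac0b.
move=> s t st sub.
have /= := sub t; rewrite !in_itv/= lexx (ltW st) => /(_ isT) /andP[at_ tS].
have /= := sub s; rewrite !in_itv/= lexx (ltW st) => /(_ isT) /andP[as_ _].
have [|c Sc tc] := @sup_gt _ S t _ tS; first by exists c0.
apply: Sc.2 => // x /=; rewrite !in_itv/= => /andP[sx xt].
by rewrite (le_trans as_ sx) (le_lt_trans xt).
Qed.

Unset Implicit Arguments.

Theorem theorem4p2 (R : realType) (E : completeNormedModType R)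
    (I : interval (\bar R)) (min_I : R)
    (min_I_in : min_I%:E \in I)
    (min_I_le : forall t : \bar R, t \in I -> (min_I%:E <= t)%E)
    (min_I_lt_sup : (min_I%:E < ereal_sup [set` I])%E)
    (g : \bar R -> E) (g_rr : right_regulated I g) :
  [/\ forall a b : R, a < b -> EFin @` `[a, b] `<=` [set` I] ->
        Riemann_integrable (fun t : R => g t%:E) a b \/
        exists c1 : R, greatest [set c | a < c <= b /\
          integrable_on_compacts (@Riemann_integrable R E)
            (fun t : R => g t%:E) a c] c1,
      forall a b : R, a < b -> EFin @` `[a, b] `<=` [set` I] ->
        Bochner_integrable (fun t : R => g t%:E) a b \/
        exists c2 : R, greatest [set c | a < c <= b /\
          integrable_on_compacts (@Bochner_integrable R E)
            (fun t : R => g t%:E) a c] c2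
    & forall a b : R, a < b -> EFin @` `[a, b] `<=` [set` I] ->
        HL_integrable (fun t : R => g t%:E) a b \/
        exists c3 : R, greatest [set c | a < c <= b /\
          integrable_on_compacts (@HL_integrable R E)
            (fun t : R => g t%:E) a c] c3].
Proof.
have local a b : a < b -> EFin @` `[a, b] `<=` [set` I] ->
    exists2 c0, a < c0 <= b & forall s t : R, s < t ->
      `[s, t]%classic `<=` `[a, c0[%classic ->
      let h x := g x%:E in
      [/\ Riemann_integrable h s t, Bochner_integrable h s t &
          HL_integrable h s t].
  move=> ab abI.
  (* A point x < b is not the supremum of I, since b belongs to I. *)
  have rg x : a <= x < b -> cvg ((fun y : R => g y%:E) @ x^'+).
    move=> /andP[ax xb]; apply: g_rr.
      by apply: abI; exists x => //=; rewrite in_itv/= ax ltW.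
    move=> x_sup; have : (b%:E <= x%:E)%E.
      rewrite x_sup; apply: ereal_sup_ubound; apply: abI.
      by exists b => //=; rewrite in_itv/= lexx ltW.
    by rewrite lee_fin leNgt xb.
  have [|M [r [ar gM]]] := right_bounded (g := fun y : R => g y%:E) (a := a).
    by apply: rg; rewrite lexx.
  exists (Num.min b r); first by rewrite lt_min ab ar ge_min lexx.
  move=> s t st sub h.
  have sub' x : s <= x <= t -> a <= x < Num.min b r.
    by move=> xst; have := sub x; rewrite /= !in_itv/=; apply.
  apply: (@integrable_bounded_right_regulated R E h M) => // x.
    move=> /sub' /andP[ax]; rewrite lt_min => /andP[_ xr].
    by apply: gM; rewrite ax.
  move=> /andP[sx xt]; apply: rg; have /sub' : s <= x <= t by rewrite sx ltW.
  by move=> /andP[->]; rewrite lt_min => /andP[->].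
by split=> a b ab /(local a b ab)[c0 ac0b int]; right;
  apply: (greatest_integrable_on_compacts ac0b) => s t st /(int s t st)[].
Qed.
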